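(* A graph on $n$ vertices requires exactly $n-1$ edge reflections to become an edgeless graph (that is, $n-1$ is the minimum number of edge reflections that transforms it into the edgeless graph on the same vertex set) if and only if it is a tree.
   Context: All graphs are finite and simple, with at least one vertex; $N(u)$ denotes the (open) neighborhood of $u$. An edge reflection $t_{uv}^X$ on a graph $G$ consists of choosing two vertices $u,v$ with $uv\in E(G)$, choosing a subset $X\subseteq N(u)\cup N(v)$ containing $u$ and $v$, and then toggling all edges between $\{u,v\}$ and $X$: that is, the edge $uv$ is deleted, and for every $w\in X\setminus\{u,v\}$ each of the pairs $uw$ and $vw$ is changed from edge to nonedge or from nonedge to edge. Reflections are applied successively, each to the graph resulting from the previous one. *)

(* Defs.v *)
From mathcomp Require Import all_boot.

Set Implicit Arguments.
Unset Strict Implicit.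
Unset Printing Implicit Defensive.

Record sgraph (T : finType) := SGraph {
  adj : rel T;
  adj_sym : symmetric adj;
  adj_irrefl : irreflexive adj }.

Section EdgeReflections.

Variable T : finType.
Implicit Types (G H : sgraph T) (u v x y : T) (X : {set T}).

Definition nbhd G u : {set T} := [set w | adj G u w].

(* [toggled_pair u v X x y]: the unordered pair xy has one end in {u, v} and
   the other in X. As x != y, the pair uv itself is toggled exactly once when
   u and v are both in X. *)
Definition toggled_pair u v X : rel T := fun x y =>
  (x != y) && ((x \in [set u; v]) && (y \in X)
               || (y \in [set u; v]) && (x \in X)).

Definition toggle_rel G u v X : rel T := fun x y =>
  adj G x y (+) toggled_pair u v X x y.

Lemma toggle_sym G u v X : symmetric (toggle_rel G u v X).
Proof.
by move=> x y; rewrite /toggle_rel /toggled_pair adj_sym eq_sym orbC.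
Qed.

Lemma toggle_irrefl G u v X : irreflexive (toggle_rel G u v X).
Proof. by move=> x; rewrite /toggle_rel /toggled_pair adj_irrefl eqxx. Qed.

(* The graph t_{uv}^X(G), total in its arguments; [reflectable] is the
   side condition under which it is an edge reflection. *)
Definition reflect_graph G u v X : sgraph T :=
  SGraph (toggle_sym G u v X) (toggle_irrefl G u v X).

Definition reflectable G u v X : Prop :=
  [/\ adj G u v, u \in X, v \in X & X \subset nbhd G u :|: nbhd G v].

Inductive reflections : nat -> sgraph T -> sgraph T -> Prop :=
| Reflections0 G : reflections 0 G G
| ReflectionsS k G H u v X :
    reflectable G u v X -> reflections k (reflect_graph G u v X) H ->
    reflections k.+1 G H.

Definition edgeless G : Prop := forall x y, ~~ adj G x y.

Definition clears_in G (k : nat) : Prop :=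
  exists2 H, reflections k G H & edgeless H.

Definition requires_exactly G (k : nat) : Prop :=
  clears_in G k /\ forall m, clears_in G m -> k <= m.

Definition connected_graph G : Prop := forall x y, connect (adj G) x y.

(* [ucycle] also accepts the empty sequence and [:: x; y] for an edge xy;
   the cycles of a graph are those of length at least 3. *)
Definition acyclic_graph G : Prop :=
  forall c : seq T, ucycle (adj G) c -> size c < 3.

Definition is_tree G : Prop := connected_graph G /\ acyclic_graph G.

End EdgeReflections.

(* Main.v *)
Require Import Defs.
From mathcomp Require Import all_boot zify.

(** In a forest u and v have no common neighbour, so a reflection at uv deletes
    uv and only redistributes the other neighbours between u and v: the result
    is a forest with at most one more component, and a tree needs at least n-1
    reflections.

    Conversely, the reflection at uv with X = {u} + N(u) isolates u, so n-1
    reflections always suffice. If G needs that many, then so does every graph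
    G' obtained by isolating u along an edge uv, and by induction G' is a tree
    on the remaining vertices. Counting edges, all edges of G lie in the same
    number t of triangles. If t = 0, G' is G with uv contracted and G is a tree.
    If t > 0, a leaf of G' other than v must be a common neighbour of u and v of
    degree 3; applying this twice produces two adjacent vertices of degree 3
    with the same other neighbours, which a single reflection isolates
    together, a contradiction. *)

Set Implicit Arguments.
Unset Strict Implicit.
Unset Printing Implicit Defensive.

Section Reflections.

Variable T : finType.
Implicit Types (G H : sgraph T) (u v w x y z : T) (X : {set T}).

(** * Adjacency after one reflection *)

Lemma reflect_graph_end G u v X a w :
  a \in [set u; v] -> w \notin [set u; v] ->
  adj (reflect_graph G u v X) a w = adj G a w (+) (w \in X).
Proof.
move=> a_uv w_uv; rewrite /= /toggle_rel /toggled_pair a_uv (negbTE w_uv) orbF.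
by rewrite (_ : a != w) //; apply: contraNneq w_uv => <-.
Qed.

Lemma reflect_graph_other G u v X x y :
  x \notin [set u; v] -> y \notin [set u; v] ->
  adj (reflect_graph G u v X) x y = adj G x y.
Proof.
move=> /negbTE x_uv /negbTE y_uv.
by rewrite /= /toggle_rel /toggled_pair x_uv y_uv andbF addbF.
Qed.

Lemma reflect_graph_uv G u v X :
  reflectable G u v X -> adj (reflect_graph G u v X) u v = false.
Proof.
case=> uv uX vX _; rewrite /= /toggle_rel /toggled_pair uv !inE !eqxx uX vX.
by case: eqVneq uv => [->|//]; rewrite adj_irrefl.
Qed.

Lemma clears_in_reflect G u v X k :
  reflectable G u v X -> clears_in (reflect_graph G u v X) k ->
  clears_in G k.+1.
Proof. by move=> r [H rH eH]; exists H => //; apply: ReflectionsS rH. Qed.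

(** * Forests *)

(* Every edge is a bridge, the two sides being the fibres of [f]. *)
Definition all_bridges G : Prop := forall x y, adj G x y ->
  exists2 f : T -> bool, f x != f y &
    forall a b, adj G a b -> f a != f b -> a \in [set x; y] /\ b \in [set x; y].

(** Colour each vertex by whether [x] reaches it without the edge [xy]. If [y] were reached, a
    simple path to it would close up with [xy] into a cycle of length at least 3. *)
Lemma acyclic_all_bridges G : acyclic_graph G -> all_bridges G.
Proof.
move=> acG x y xy.
pose e := [rel a b | adj G a b && ~~ ((a \in [set x; y]) && (b \in [set x; y]))].
have e_sym : symmetric e by move=> a b; rewrite /= adj_sym [(b \in _) && _]andbC.
exists (connect e x) => [|a b ab]; last first.
  case: (boolP (e a b)) => [eab|]; last by rewrite /= ab negbK => /andP[].
  by rewrite (same_connect1r (sym_connect_sym e_sym) eab) eqxx.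
rewrite connect0; case: (boolP (connect e x y)) => // /connectP[p].
case/shortenP=> q qP q_uniq _ def_y.
have cycle_q : ucycle (adj G) (x :: q).
  rewrite /ucycle q_uniq /= rcons_path -def_y adj_sym xy !andbT.
  by apply: sub_path qP => a b /andP[].
move: (acG _ cycle_q) qP def_y; case: q {q_uniq cycle_q} => [|a [|b q]] //=.
  by move=> _ _ eq_xy; rewrite eq_xy adj_irrefl in xy.
by move=> _ /andP[/andP[_ xa] _] eq_y; rewrite eq_y !inE !eqxx orbT in xa.
Qed.

Lemma all_bridges_triangle_free G u v w :
  all_bridges G -> adj G u v -> adj G u w -> adj G v w -> False.
Proof.
move=> brG uv uw vw; have [f fuv fP] := brG _ _ uv.
have w_uv : w \notin [set u; v].
  by rewrite !inE; apply/orP=> -[]/eqP eq_w; rewrite eq_w adj_irrefl in uw vw.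
have fuw : f u = f w.
  by apply/eqP/(contraNT _ w_uv) => /(fP _ _ uw)[].
case/negP: w_uv; apply: (proj2 (fP _ _ vw _)).
by rewrite -fuw eq_sym.
Qed.

(* An edge xy of the new graph outside {u, v} keeps its colouring; a new edge
   xy with x in {u, v} inherits the colouring of the old edge joining y to u or
   to v. In both cases u and v have the same colour. *)
Lemma all_bridges_reflect G u v X :
  reflectable G u v X -> all_bridges G -> all_bridges (reflect_graph G u v X).
Proof.
move=> rG brG; have [uv uX vX X_sub] := rG; set G' := reflect_graph G u v X.
have uv'F : forall a b, a \in [set u; v] -> b \in [set u; v] -> adj G' a b -> False.
  move=> a b; rewrite !inE => /orP[]/eqP-> /orP[]/eqP->; rewrite ?adj_irrefl //.
    by rewrite reflect_graph_uv.
  by rewrite adj_sym reflect_graph_uv.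
have link a w : a \in [set u; v] -> w \notin [set u; v] -> adj G' a w ->
    exists2 z, z \in [set u; v] & adj G z w.
  move=> a_uv w_uv; rewrite reflect_graph_end //.
  case aw: (adj G a w); first by exists a.
  move/(subsetP X_sub); rewrite !inE => /orP[uw|vw].
    by exists u; rewrite ?inE ?eqxx.
  by exists v; rewrite ?inE ?eqxx ?orbT.
(* At most one of [u], [v] is joined to [w] in [G]. If [w] is in [X], exactly one is, and toggling
   swaps it for the other. *)
have no_common w : w \notin [set u; v] -> adj G' u w -> adj G' v w -> False.
  move=> w_uv; rewrite !reflect_graph_end ?set21 ?set22 //.
  have t : ~~ (adj G u w && adj G v w).
    by apply/negP=> /andP[]; apply: all_bridges_triangle_free.
  have : (w \in X) ==> (adj G u w || adj G v w).
    by apply/implyP=> /(subsetP X_sub); rewrite !inE.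
  by move: t; case: (w \in X); case: (adj G u w); case: (adj G v w).
have ends x y : x \in [set u; v] -> y \notin [set u; v] -> adj G' x y ->
  exists2 f : T -> bool, f x != f y &
    forall a b, adj G' a b -> f a != f b -> a \in [set x; y] /\ b \in [set x; y].
  move=> x_uv y_uv xy; have [z z_uv zy] := link _ _ x_uv y_uv xy.
  have [f fzy fP] := brG _ _ zy; have fuv : f u = f v.
    apply/eqP; apply: (contraTT _ uv) => /(fP _ _ uv)[].
    rewrite !inE in y_uv *; case/norP: y_uv => uy vy.
    by rewrite ![_ == y]eq_sym (negbTE uy) (negbTE vy) !orbF => /eqP-> /eqP->;
      rewrite adj_irrefl.
  have f_const a b : a \in [set u; v] -> b \in [set u; v] -> f a = f b.
    by rewrite !inE => /orP[]/eqP-> /orP[]/eqP->.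
  have half a b : a \in [set u; v] -> b \notin [set u; v] -> adj G' a b ->
      f a != f b -> a = x /\ b = y.
    move=> a_uv b_uv ab; have [z' z'_uv z'b] := link _ _ a_uv b_uv ab.
    rewrite (f_const a z') // => /(fP _ _ z'b)[_].
    rewrite !inE; case: eqP b_uv => [->|_ b_uv]; first by rewrite z_uv.
    move=> /eqP eq_b; split=> //; subst b.
    move: a_uv x_uv ab xy; rewrite !inE.
    by move=> /orP[]/eqP-> /orP[]/eqP-> //; have := no_common _ y_uv; tauto.
  exists f => [|a b]; first by rewrite (f_const x z).
  case: (boolP (a \in [set u; v])) (boolP (b \in [set u; v])) =>
    a_uv [] b_uv ab fab.
  - by case: (uv'F a b).
  - by case: (half a b) => // -> ->; rewrite !inE !eqxx orbT.
  - rewrite adj_sym in ab; rewrite eq_sym in fab.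
    by case: (half b a) => // -> ->; rewrite !inE !eqxx orbT.
  - rewrite reflect_graph_other // in ab.
    have [] := fP _ _ ab fab; rewrite !inE.
    case: eqP a_uv => [->|_ _ /eqP eq_a]; first by rewrite z_uv.
    case: eqP b_uv => [->|_ _ /eqP eq_b]; first by rewrite z_uv.
    by rewrite eq_a eq_b adj_irrefl in ab.
move=> x y xy.
case: (boolP (x \in [set u; v])) (boolP (y \in [set u; v])) => x_uv [] y_uv.
- by case: (uv'F x y).
- exact: ends.
- rewrite adj_sym in xy; have [f fyx fP] := ends y x y_uv x_uv xy.
  by exists f => [|a b]; [rewrite eq_sym | rewrite setUC; apply: fP].
rewrite reflect_graph_other // in xy; have [f fxy fP] := brG _ _ xy.
have f_const a b : a \in [set u; v] -> b \in [set u; v] -> f a = f b.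
  have fuv : f u = f v.
    apply/eqP; apply: (contraTT _ x_uv) => /(fP _ _ uv)[].
    rewrite !inE negbK => /orP[/eqP->|uy]; first by rewrite eqxx.
    case/orP=> [/eqP->|vy]; first by rewrite eqxx orbT.
    by rewrite (eqP uy) (eqP vy) adj_irrefl in uv.
  by rewrite !inE => /orP[]/eqP-> /orP[]/eqP->.
have half a b : a \in [set u; v] -> b \notin [set u; v] -> adj G' a b ->
    f a = f b.
  move=> a_uv b_uv ab; have [z z_uv zb] := link _ _ a_uv b_uv ab.
  rewrite (f_const a z) //; apply/eqP; apply: (contraTT _ z_uv).
  case/(fP _ _ zb); rewrite !inE => /orP[]/eqP-> _.
    by rewrite !inE in x_uv.
  by rewrite !inE in y_uv.
exists f => // a b.
case: (boolP (a \in [set u; v])) (boolP (b \in [set u; v])) =>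
  a_uv [] b_uv ab.
- by case: (uv'F a b).
- by rewrite (half a b) ?eqxx.
- by rewrite (half b a) ?eqxx // adj_sym.
- by apply: fP; rewrite -(reflect_graph_other G X a_uv b_uv).
Qed.

(* Each reflection merges at most two classes of the labelling, read from the
   edgeless graph backwards. *)
Lemma reflections_labelling k G H :
  all_bridges G -> reflections k G H -> edgeless H ->
  exists2 f : T -> T, (forall x y, adj G x y -> f x = f y) &
    #|T| <= #|f @: [set: T]| + k.
Proof.
move=> + r; elim: r => {k G H} [G _ eG|k G H u v X rG r IH brG eH].
  exists id => [x y xy|]; first by rewrite (negbTE (eG x y)) in xy.
  by rewrite imset_id addn0 cardsT.
have [f fP le_f] := IH (all_bridges_reflect rG brG) eH.
have [uv uX vX X_sub] := rG.
pose g x := if f x == f u then f v else f x.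
have g_uv a : a \in [set u; v] -> g a = f v.
  by rewrite !inE /g => /orP[]/eqP->; rewrite ?eqxx //; case: eqP.
(* Exactly one of [u], [v] is joined to [w] in [G], hence also after the reflection, so [f w] is one
   of the two merged labels. *)
have half a w : a \in [set u; v] -> w \notin [set u; v] -> adj G a w ->
    g w = f v.
  move=> a_uv w_uv aw; suff : (f w == f u) || (f w == f v).
    by rewrite /g; case: eqP => //= _ /eqP.
  have [u_uv v_uv] : u \in [set u; v] /\ v \in [set u; v].
    by rewrite !inE !eqxx orbT.
  have := fP u w; have := fP v w; rewrite !reflect_graph_end //.
  have t : ~~ (adj G u w && adj G v w).
    by apply/negP=> /andP[]; apply: all_bridges_triangle_free.
  move: t a_uv aw; rewrite !inE => t /orP[]/eqP-> aw; move: t; rewrite aw ?andbT /=.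
    by case: (w \in X); case: (adj G v w) => //= _;
      [move=> /(_ isT)-> _ | move=> _ /(_ isT)->]; rewrite eqxx ?orbT.
  by case: (w \in X); case: (adj G u w) => //= _;
    [move=> _ /(_ isT)-> | move=> /(_ isT)-> _]; rewrite eqxx ?orbT.
exists g => [x y xy|].
  case: (boolP (x \in [set u; v])) (boolP (y \in [set u; v])) =>
    x_uv [] y_uv.
  - by rewrite !g_uv.
  - by rewrite g_uv // (half x).
  - by rewrite [RHS]g_uv // (half y) // adj_sym.
  - by rewrite /g (fP x y) // reflect_graph_other.
(* The merge loses at most the label [f u], which pays for one reflection. *)
have f_sub : f @: [set: T] \subset f u |: g @: [set: T].
  apply/subsetP=> _ /imsetP[x _ ->]; rewrite !inE; case: eqP => //= /eqP/negbTE ne.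
  by apply/imsetP; exists x; rewrite // /g ne.
have := leq_trans (subset_leq_card f_sub) (leq_of_leqif (leq_card_setU _ _)).
by rewrite cards1; lia.
Qed.

(** * Isolating an end of an edge *)

(** For an edge [uv] this cuts [u] off; apart from [u] and [v] themselves, [v] ends up joined to the
    symmetric difference of the two neighbourhoods. *)
Definition isolate G u v : sgraph T := reflect_graph G u v (u |: nbhd G u).

Arguments isolate : simpl never.

(** The non-isolated vertices: isolating a vertex shrinks this set while the vertex type stays
    fixed, so inductions run on its size. *)
Definition support G : {set T} := [set x | [exists y, adj G x y]].

Definition common G u v : {set T} := nbhd G u :&: nbhd G v.

Lemma support_adj G x y : adj G x y -> x \in support G /\ y \in support G.
Proof.
move=> xy; split; rewrite inE; apply/existsP; first by exists y.
by exists x; rewrite adj_sym.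
Qed.

Lemma support0_edgeless G : support G = set0 -> edgeless G.
Proof.
move=> supp0 x y; apply/negP=> /support_adj[+ _].
by rewrite supp0 inE.
Qed.

Lemma isolate_reflectable G u v : adj G u v -> reflectable G u v (u |: nbhd G u).
Proof.
move=> uv; split; rewrite ?inE ?eqxx ?uv ?orbT //.
by apply/subsetP=> w; rewrite !inE => /orP[/eqP->|->//]; rewrite adj_sym uv orbT.
Qed.

Section Isolate.

Variables (G : sgraph T) (u v : T).
Hypothesis uv : adj G u v.

Let uNv : u != v. Proof. by apply: contraTneq uv => ->; rewrite adj_irrefl. Qed.

Lemma isolate_end x : adj (isolate G u v) u x = false.
Proof.
case: (eqVneq x u) => [->|xu]; first exact: adj_irrefl.
case: (eqVneq x v) => [->|xv].
  by apply: reflect_graph_uv; apply: isolate_reflectable.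
rewrite reflect_graph_end ?set21 //; last by rewrite !inE negb_or xu xv.
by rewrite !inE (negbTE xu) addbb.
Qed.

Lemma isolate_other_end x : x != u -> x != v ->
  adj (isolate G u v) v x = adj G v x (+) adj G u x.
Proof.
move=> xu xv; rewrite reflect_graph_end ?set22 //.
  by rewrite !inE (negbTE xu).
by rewrite !inE negb_or xu.
Qed.

Lemma isolate_other x y : x != u -> x != v -> y != u -> y != v ->
  adj (isolate G u v) x y = adj G x y.
Proof. by move=> xu xv yu yv; rewrite reflect_graph_other ?inE ?negb_or ?xu ?yu. Qed.

Lemma support_isolate : support (isolate G u v) \subset support G :\ u.
Proof.
apply/subsetP=> x; rewrite !inE => /existsP[y xy].
have xu : x != u by apply: contraTneq xy => ->; rewrite isolate_end.
have yu : y != u by apply: contraTneq xy => ->; rewrite adj_sym isolate_end.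
rewrite xu /=; apply/existsP; case: (eqVneq x v) => [->|xv].
  by exists u; rewrite adj_sym.
case: (eqVneq y v) => [eq_y|yv]; last by exists y; rewrite -isolate_other.
move: xy; rewrite eq_y adj_sym isolate_other_end // ![adj G _ x]adj_sym.
by case vx: (adj G x v); [exists v | exists u].
Qed.

(** An edge [vz] created by the isolation is replaced by the path [v], [u], [z] of [G]. *)
Lemma connect_isolate x y :
  connect (adj (isolate G u v)) x y -> connect (adj G) x y.
Proof.
apply: connect_sub => {}x {}y xy.
have xu : x != u by apply: contraTneq xy => ->; rewrite isolate_end.
have yu : y != u by apply: contraTneq xy => ->; rewrite adj_sym isolate_end.
have v_to z : z != u -> adj (isolate G u v) v z -> connect (adj G) v z.
  move=> zu vz; have zv : z != v by apply: contraTneq vz => ->; rewrite adj_irrefl.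
  move: vz; rewrite isolate_other_end //.
  case vz: (adj G v z); first by move=> _; apply: connect1.
  move=> uz; apply: (connect_trans (y := u)); apply: connect1 => //.
  by rewrite adj_sym.
case: (eqVneq x v) => [eq_x|xv]; first by rewrite eq_x in xy *; apply: v_to.
case: (eqVneq y v) => [eq_y|yv]; last by apply: connect1; rewrite -isolate_other.
by rewrite eq_y adj_sym in xy; rewrite eq_y (sym_connect_sym (@adj_sym _ G)); apply: v_to.
Qed.

(** A common neighbour loses both [u] and [v]; a neighbour of [u] alone trades [u] for [v]. *)
Lemma deg_isolate_other x : x != u -> x != v ->
  #|nbhd G x| = #|nbhd (isolate G u v) x| + 2 * (x \in common G u v).
Proof.
move=> xu xv; rewrite -!sum1_card !(big_mkcond (fun y => y \in _)) /=.
rewrite (bigD1 u) //= (bigD1 v) 1?eq_sym //= [in RHS](bigD1 u) //=.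
rewrite [in RHS](bigD1 v) 1?eq_sym //= !inE ![adj _ x u]adj_sym ![adj _ x v]adj_sym.
rewrite isolate_end isolate_other_end //.
rewrite [in RHS](eq_bigr (fun y => if y \in nbhd G x then 1 else 0)).
  by case: (adj G u x); case: (adj G v x) => /=; lia.
by move=> y /andP[yu yv]; rewrite !inE isolate_other.
Qed.

Lemma deg_isolate_ends :
  #|nbhd G u| + #|nbhd G v| =
  #|nbhd (isolate G u v) v| + 2 * #|common G u v| + 2.
Proof.
rewrite -!sum1_card !(big_mkcond (fun y => y \in _)) /=.
have split2 (F : T -> nat) :
    \sum_y F y = F u + (F v + \sum_(y | (y != u) && (y != v)) F y).
  by rewrite (bigD1 u) //= (bigD1 v) 1?eq_sym.
rewrite !{}split2 !inE !adj_irrefl uv ![adj _ v u]adj_sym uv isolate_end andbF /=.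
rewrite !add0n addnACA addnC; congr (_ + 2).
rewrite -big_split big_distrr -big_split /=.
apply: eq_bigr => y /andP[yu yv]; rewrite !inE isolate_other_end //.
by case: (adj G u y); case: (adj G v y).
Qed.

(** Each common neighbour costs two edges, and [uv] is one more; every edge counts twice. *)
Lemma sum_deg_isolate :
  \sum_x #|nbhd G x| =
  \sum_x #|nbhd (isolate G u v) x| + 4 * #|common G u v| + 2.
Proof.
have c0 : #|nbhd (isolate G u v) u| = 0.
  by apply/eqP; rewrite cards_eq0; apply/eqP/setP=> x; rewrite !inE isolate_end.
rewrite (bigD1 u) //= (bigD1 v) 1?eq_sym //= [in RHS](bigD1 u) //=.
rewrite [in RHS](bigD1 v) 1?eq_sym //= c0 addnA deg_isolate_ends.
rewrite (eq_bigr (fun x => #|nbhd (isolate G u v) x| + 2 * (x \in common G u v))).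
  rewrite big_split /= -big_distrr /=.
  have -> : \sum_(x | (x != u) && (x != v)) (x \in common G u v) = #|common G u v|.
    rewrite -sum1_card [in RHS]big_mkcond /= [in RHS](bigD1 u) //=.
    rewrite [in RHS](bigD1 v) 1?eq_sym //= !inE !adj_irrefl andbF /= !add0n.
    by apply: eq_bigr => x _; case: (x \in _).
  by lia.
by move=> x /andP[xu xv]; rewrite deg_isolate_other.
Qed.

(** Without common neighbours the isolation contracts [uv], so a cycle through [uv] becomes one
    vertex shorter. *)
Lemma isolate_ucycle c :
  common G u v = set0 -> ucycle (adj G) [:: u, v & c] -> 0 < size c ->
  ucycle (adj (isolate G u v)) (v :: c).
Proof.
move: isolate_other_end isolate_other; move: (isolate G u v) => G' iso_v iso.
move=> no_com /andP[/= /andP[_ path_c] /and3P[]].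
rewrite inE negb_or => /andP[_ uc] vc c_uniq; rewrite /ucycle /= vc c_uniq andbT.
have com w : adj G u w -> adj G v w -> False.
  by move=> uw vw; have := in_set0 w; rewrite -no_com !inE uw vw.
case: c uc vc path_c {c_uniq} => [|a c] //=.
rewrite !inE !negb_or => /andP[ua uc] /andP[va vc].
rewrite !rcons_path => /andP[vw /andP[path_c last_u]] _.
rewrite iso_v 1?eq_sym // vw /=.
have -> /= : adj G u a = false by apply/negP=> /com; apply.
have last_uv : last a c != u /\ last a c != v.
  have := mem_last a c; rewrite inE => /orP[/eqP->|lc].
    by rewrite ![a == _]eq_sym.
  by split; [apply: contraNneq uc => <- | apply: contraNneq vc => <-].
case: last_uv => lu lv.
rewrite adj_sym in last_u; rewrite [adj _ (last _ _) _]adj_sym iso_v // last_u.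
have -> /= : adj G v (last a c) = false by apply/negP; apply: com.
rewrite andbT.
elim: c a ua va uc vc path_c {vw last_u lu lv} => //= b c IH a ua va.
rewrite !inE !negb_or => /andP[ub uc] /andP[vb vc] /andP[ab path_c].
by rewrite iso 1?eq_sym // ab IH.
Qed.

End Isolate.

(** * Upper bound by isolating vertices one at a time *)

(** Each step isolates at least one vertex, and the last one isolates both ends of an edge, whence
    the strict inequality. *)
Lemma clears_in_lt_support G :
  0 < #|support G| -> exists2 k, clears_in G k & k < #|support G|.
Proof.
have [n] := ubnP #|support G|; elim: n G => // n IH G le_n supp_gt0.
have /card_gt0P[u] := supp_gt0; rewrite inE => /existsP[v uv].
have [u_supp v_supp] := support_adj uv.
have le_supp := subset_leq_card (support_isolate uv).
have := cardsD1 u (support G); rewrite u_supp => card_supp.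
have rG := isolate_reflectable uv.
case: (posnP #|support (isolate G u v)|) => [supp0|supp_gt].
  exists 1.
    apply: (clears_in_reflect rG); exists (isolate G u v); first exact: Reflections0.
    by apply: support0_edgeless; apply/eqP; rewrite -cards_eq0 supp0.
  have : v \in support G :\ u.
    by rewrite !inE in v_supp *; rewrite v_supp; case: eqP uv => // ->; rewrite adj_irrefl.
  by rewrite card_supp ltnS card_gt0 => vS; apply/set0Pn; exists v.
have [|k clr lt_k] := IH _ _ supp_gt; first by lia.
by exists k.+1; [apply: clears_in_reflect clr | lia].
Qed.

(** * Graphs that cannot be cleared faster than their support allows *)

Definition hard G : Prop := forall k, clears_in G k -> #|support G| <= k.+1.

(** The last clause is the edge count of a tree, doubled; it is carried along for the counting
    arguments. *)
Definition tree_on_support G : Prop :=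
  [/\ {in support G &, forall x y, connect (adj G) x y}, acyclic_graph G &
      (\sum_x #|nbhd G x|).+2 = 2 * #|support G|].

(** Otherwise all degrees on the support are at least 2, except perhaps 1 at [v], and their sum
    exceeds that of a tree. *)
Lemma tree_on_support_leaf G v : tree_on_support G ->
  exists x, [/\ x \in support G, x != v & #|nbhd G x| = 1].
Proof.
case=> _ _ sum_deg.
case: (pickP [pred x | [&& x \in support G, x != v & #|nbhd G x| == 1]]).
  by move=> x /and3P[? ? /eqP ?]; exists x.
move=> no_leaf.
have : \sum_x 2 * (x \in support G) <= \sum_x (#|nbhd G x| + (x == v)).
  apply: leq_sum => x _; have := no_leaf x; rewrite inE /=.
  case xS: (x \in support G) => //=.
  have : 0 < #|nbhd G x|.
    by move: xS; rewrite inE => /existsP[y xy]; apply/card_gt0P; exists y; rewrite inE.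
  by case: (x == v) => /=; lia.
rewrite -big_distrr big_split /=.
rewrite -(big_mkcond (fun x => x \in support G) (fun=> 1)) sum1_card.
rewrite -(big_mkcond (fun x => x == v) (fun=> 1)) big_pred1_eq; lia.
Qed.

(** If one reflection removed a second vertex from the support, or the rest could be cleared faster,
    [G] would be cleared too fast. *)
Lemma hard_isolate G u v : adj G u v -> hard G -> 2 < #|support G| ->
  support (isolate G u v) = support G :\ u /\ hard (isolate G u v).
Proof.
move=> uv hG supp_gt2; have rG := isolate_reflectable uv.
have [u_supp v_supp] := support_adj uv.
have := cardsD1 u (support G); rewrite u_supp => card_supp.
have le_card : #|support G :\ u| <= #|support (isolate G u v)|.
  case: (posnP #|support (isolate G u v)|) => [supp0|/clears_in_lt_support[k clr lt_k]].
    have /hG : clears_in G 1.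
      apply: (clears_in_reflect rG); exists (isolate G u v); first exact: Reflections0.
      by apply: support0_edgeless; apply/eqP; rewrite -cards_eq0 supp0.
    by lia.
  by have := hG _ (clears_in_reflect rG clr); lia.
have eq_supp : support (isolate G u v) = support G :\ u.
  by apply/eqP; rewrite eqEcard support_isolate.
split=> // k clr; have := hG _ (clears_in_reflect rG clr).
by rewrite eq_supp; lia.
Qed.

(* Twins [x] and [z] would be isolated together. *)
Lemma hard_no_twins G x z : hard G -> 2 < #|support G| -> adj G x z ->
  (forall w, w != x -> w != z -> adj G x w = adj G z w) -> False.
Proof.
move=> hG supp_gt2 xz twins; have [eq_supp _] := hard_isolate xz hG supp_gt2.
have [_ zS] := support_adj xz.
have zx : z != x by apply: contraTneq xz => ->; rewrite adj_irrefl.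
have : z \in support (isolate G x z) by rewrite eq_supp in_setD1 zx.
rewrite inE => /existsP[w zw].
have wx : w != x by apply: contraTneq zw => ->; rewrite adj_sym isolate_end.
have wz : w != z by apply: contraTneq zw => ->; rewrite adj_irrefl.
by move: zw; rewrite isolate_other_end // twins ?addbb.
Qed.

Lemma hard_triangle_free G u v :
  hard G -> 2 < #|support G| ->
  (forall x y, adj G x y -> tree_on_support (isolate G x y)) ->
  adj G u v -> common G u v = set0.
Proof.
move=> hG supp_gt2 trees.
(* The tree left by isolating [x] has a known edge count, so the number of triangles on [xy] does
   not depend on the edge. *)
have card_common x y : adj G x y ->
    (\sum_z #|nbhd G z|).+2 = 2 * #|support G| + 4 * #|common G x y|.
  move=> xy; have [_ _ sum_deg] := trees _ _ xy.
  have [eq_supp _] := hard_isolate xy hG supp_gt2.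
  have [xS _] := support_adj xy; have := cardsD1 x (support G); rewrite xS.
  by rewrite (sum_deg_isolate xy) -eq_supp; lia.
move=> uv; apply/eqP; apply/idPn; rewrite -card_gt0 => t_gt0.
have t_const x y : adj G x y -> #|common G x y| = #|common G u v|.
  by move=> xy; have := card_common _ _ xy; have := card_common _ _ uv; lia.
have deg_gt x y : adj G x y -> #|common G u v| < #|nbhd G x|.
  move=> xy; rewrite -(t_const _ _ xy) (cardsD1 y (nbhd G x)) inE xy ltnS.
  apply/subset_leq_card/subsetP=> w; rewrite !inE => /andP[-> yw].
  by rewrite andbT; apply: contraTneq yw => ->; rewrite adj_irrefl.
(* A leaf [z] of that tree, other than [y], has degree at least 2 in [G], so it lost two neighbours:
   it is common to [x] and [y] and had degree 3. *)
have leaf x y : adj G x y ->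
    exists z, [/\ adj G x z, adj G y z & #|nbhd G z| = 3].
  move=> xy; have [z [zS zy deg1]] := tree_on_support_leaf y (trees _ _ xy).
  have [eq_supp _] := hard_isolate xy hG supp_gt2.
  move: zS; rewrite eq_supp 2!inE => /andP[zx].
  rewrite inE => /existsP[w /deg_gt].
  have := deg_isolate_other xy zx zy; rewrite deg1.
  case com: (z \in common G x y)=> deg_z; last by lia.
  by move: com; rewrite !inE => /andP[xz yz] _; exists z.
have [x [ux _ deg_x]] := leaf _ _ uv.
rewrite adj_sym in ux; have [z [xz uz deg_z]] := leaf _ _ ux.
have zu : z != u by apply: contraTneq uz => ->; rewrite adj_irrefl.
have t_le2 : #|common G u v| <= 2 by have := deg_gt _ _ xz; rewrite deg_x.
(* Let [y] be the third neighbour of [x]. The edge [xy] lies in a triangle with [u] or [z]; then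
   [xu], respectively [xz], lies in two triangles. *)
have t2 : 1 < #|common G u v|.
  have [y] : exists y, y \in nbhd G x :\: [set u; z].
    apply/card_gt0P; have := cardsID [set u; z] (nbhd G x).
    by have := subset_leq_card (subsetIr (nbhd G x) [set u; z]); rewrite cards2; lia.
  rewrite !inE negb_or => /andP[/andP[yu yz] xy].
  have [p] : exists p, p \in common G x y by apply/card_gt0P; rewrite t_const.
  rewrite !inE => /andP[xp yp].
  have py : p != y by apply: contraTneq yp => ->; rewrite adj_irrefl.
  have two a b c : adj G x a -> b != c -> b \in common G x a ->
      c \in common G x a -> 1 < #|common G u v|.
    move=> xa bc ba ca; rewrite -(t_const _ _ xa).
    have <- : #|[set b; c]| = 2 by rewrite cards2 bc.
    by apply: subset_leq_card; apply/subsetP=> d; rewrite !inE => /orP[]/eqP->;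
      move: ba ca; rewrite !inE.
  have : p \in [set u; z].
    have /eqP-> : [set u; z] == nbhd G x :\ y.
      rewrite eqEcard cards2 eq_sym zu; apply/andP; split.
        apply/subsetP=> d; rewrite !inE => /orP[]/eqP->.
          by rewrite eq_sym yu ux.
        by rewrite eq_sym yz xz.
      by have := cardsD1 y (nbhd G x); rewrite inE xy deg_x; lia.
    by rewrite !inE py.
  rewrite !inE => /orP[]/eqP eq_p; rewrite {p}eq_p in xp yp py.
    by apply: (two u y z); rewrite // !inE ?xz ?uz // xy adj_sym.
  by apply: (two z u y); rewrite 1?eq_sym // !inE ?xy ?ux adj_sym.
(* Two common neighbours exhaust the neighbours of [a] other than [b]; this makes [x] and [z]
   twins. *)
have twin a b : adj G a b -> #|nbhd G a| = 3 -> common G a b = nbhd G a :\ b.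
  move=> ab deg_a; apply/eqP; rewrite eqEcard; apply/andP; split.
    apply/subsetP=> w; rewrite !inE => /andP[-> bw].
    by rewrite andbT; apply: contraTneq bw => ->; rewrite adj_irrefl.
  by have := cardsD1 b (nbhd G a); rewrite inE ab deg_a t_const //; lia.
apply: (hard_no_twins hG supp_gt2 xz) => w wx wz.
have zx : adj G z x by rewrite adj_sym.
have := twin _ _ zx deg_z; rewrite /common setIC -/(common G x z) (twin _ _ xz deg_x).
by move/setP/(_ w); rewrite !inE wx wz.
Qed.

Lemma hard_tree_on_support G : 0 < #|support G| -> hard G -> tree_on_support G.
Proof.
have [n] := ubnP #|support G|; elim: n G => // n IH G le_n supp_gt0 hG.
have /card_gt0P[u] := supp_gt0; rewrite inE => /existsP[v uv].
have [u_supp v_supp] := support_adj uv.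
have uNv : u != v by apply: contraTneq uv => ->; rewrite adj_irrefl.
have cycle_supp c : ucycle (adj G) c -> size c <= #|support G|.
  move=> /andP[cyc c_uniq]; rewrite -(card_uniqP c_uniq).
  apply/subset_leq_card/subsetP=> x xc.
  by have /support_adj[] := next_cycle cyc xc.
case: (leqP #|support G| 2) => [le2|supp_gt2].
  have suppE : support G = [set u; v].
    apply/esym/eqP; rewrite eqEcard cards2 uNv le2 andbT.
    by apply/subsetP=> w /set2P[]->.
  have com0 : common G u v = set0.
    apply/setP=> w; rewrite !inE; apply/negP=> /andP[uw vw].
    have [_] := support_adj uw; rewrite suppE !inE => /orP[]/eqP eq_w.
      by rewrite eq_w adj_irrefl in uw.
    by rewrite eq_w adj_irrefl in vw.
  split=> [x y||].
  - rewrite suppE !inE => /orP[]/eqP-> /orP[]/eqP->; rewrite ?connect0 ?connect1 //.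
    by rewrite adj_sym.
  - by move=> c /cycle_supp le_c; rewrite ltnS; apply: leq_trans le_c le2.
  rewrite (sum_deg_isolate uv) com0 suppE cards2 uNv cards0 big1 // => x _.
  apply/eqP; rewrite cards_eq0; apply/eqP/setP=> y; rewrite !inE.
  apply/negP=> xy; have [xS yS] := support_adj xy.
  have := subsetP (support_isolate uv) _ xS; have := subsetP (support_isolate uv) _ yS.
  rewrite suppE ![_ \in _ :\ _]inE !inE.
  case: eqP => //= _ /eqP eq_y; case: eqP => //= _ /eqP eq_x.
  by rewrite eq_x eq_y adj_irrefl in xy.
have trees x y : adj G x y -> tree_on_support (isolate G x y).
  move=> xy; have [eq_supp h] := hard_isolate xy hG supp_gt2.
  have [xS _] := support_adj xy; have := cardsD1 x (support G); rewrite xS => cS.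
  by apply: IH; rewrite // eq_supp; lia.
have t0 x y : adj G x y -> common G x y = set0.
  exact: hard_triangle_free.
split.
- have to_v x : x \in support G -> connect (adj G) x v.
    case: (eqVneq x u) => [-> _|xu xS]; first exact: connect1.
    have [con _ _] := trees _ _ uv; have [eq_supp _] := hard_isolate uv hG supp_gt2.
    apply: (connect_isolate uv); apply: con; rewrite eq_supp in_setD1.
      by rewrite xu.
    by rewrite eq_sym uNv.
  move=> x y xS yS; apply: connect_trans (to_v x xS) _.
  by rewrite (sym_connect_sym (@adj_sym _ G)) to_v.
(* A 3-cycle is a triangle; a longer cycle contracts to a cycle of length at least 3 in a tree. *)
- move=> [|a [|b [|d [|e c]]]] // cyc.
    move: cyc => /andP[/and4P[ab bd da _] _].
    have := in_set0 d; rewrite -(t0 _ _ ab) !inE bd andbT => /negbT/negP; case.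
    by rewrite adj_sym.
  have ab : adj G a b by case/andP: cyc => /andP[].
  have [_ acy _] := trees _ _ ab.
  by have := acy _ (isolate_ucycle (t0 _ _ ab) cyc isT).
have [_ _ sum_deg] := trees _ _ uv; have [eq_supp _] := hard_isolate uv hG supp_gt2.
have := cardsD1 u (support G); rewrite u_supp (sum_deg_isolate uv) (t0 _ _ uv) cards0.
by rewrite -eq_supp; lia.
Qed.

End Reflections.

(** * Trees are exactly the graphs that attain the bound *)

Theorem theorem4p3p4 (n : nat) (T : finType) (G : sgraph T)
    (n_gt0 : 0 < n) (cardT : #|T| = n) :
  requires_exactly G (n - 1) <-> is_tree G.
Proof.
have clear_le : exists2 k, clears_in G k & k <= n - 1.
  case: (posnP #|support G|) => [/eqP|/clears_in_lt_support[k clr lt_k]].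
    rewrite cards_eq0 => /eqP/support0_edgeless eG.
    by exists 0 => //; exists G => //; apply: Reflections0.
  by exists k => //; have := max_card (support G); lia.
split=> [[clr min_clr]|[conG acG]]; last first.
  have lower k : clears_in G k -> n - 1 <= k.
    case=> H rH eH.
    have [f fP] := reflections_labelling (acyclic_all_bridges acG) rH eH.
    (* Connectedness leaves a single label, so at least [n - 1] reflections were used. *)
    have : #|f @: [set: T]| <= 1.
      apply/card_le1_eqP=> _ _ /imsetP[x _ ->] /imsetP[y _ ->].
      have /connectP[p] := conG x y; elim: p x => [|z p IH] x /=; first by move=> _ ->.
      by case/andP=> /fP-> /IH; apply.
    by lia.
  split=> //; have [k clr le_k] := clear_le.
  by have -> : n - 1 = k by apply/eqP; rewrite eqn_leq le_k lower.
case: (leqP n 1) => [n_le1|n_gt1].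
  split=> [x y|c /andP[_ c_uniq]].
    by have /card_le1_eqP/(_ x y isT isT)-> : #|T| <= 1 by rewrite cardT.
  by rewrite -(card_uniqP c_uniq) (leq_ltn_trans (max_card _)) // cardT; lia.
(* With an isolated vertex, fewer than [n - 1] reflections would suffice, as [n] is at least 2. *)
have supp_card : #|support G| = n.
  apply/eqP; rewrite eqn_leq -{1}cardT max_card /=.
  case: (posnP #|support G|) => [/eqP|/clears_in_lt_support[k /min_clr]]; last by lia.
  rewrite cards_eq0 => /eqP/support0_edgeless eG.
  have : clears_in G 0 by exists G => //; apply: Reflections0.
  by move/min_clr; lia.
have /hard_tree_on_support[|con acy _] : 0 < #|support G| by lia.
  by move=> k /min_clr; lia.
have suppT x : x \in support G.
  suff -> : support G = [set: T] by rewrite inE.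
  by apply/eqP; rewrite eqEcard subsetT cardsT supp_card cardT /=.
by split=> // x y; apply: con.
Qed.
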